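(* For all integers $n>4$, $b_{2,2}(n)\geq b_{2,1}(n)$.
   Context: A $2$-regular partition of $n$ is a partition of $n$ with no even parts (i.e. a partition into odd parts). The hook length of a box in the Young diagram of a partition (rows of lengths $\lambda_1\geq\lambda_2\geq\cdots$, left-justified) is the number of boxes directly to its right plus the number directly below it plus $1$. For $k\geq1$, $b_{2,k}(n)$ denotes the total number of boxes of hook length $k$, counted over all $2$-regular partitions of $n$. *)

(* Defs.v *)
From mathcomp Require Import all_boot.

Set Implicit Arguments.
Unset Strict Implicit.
Unset Printing Implicit Defensive.

(* A partition is the sequence of its nonzero parts in weakly decreasing
   order. *)
Definition is_partition (n : nat) (s : seq nat) : bool :=
  [&& sorted geq s, 0 \notin s & sumn s == n].

(* The partitions of n with all parts at most m; k is the multiplicity of the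
   part m. *)
Fixpoint partitions_le (m n : nat) : seq (seq nat) :=
  if m is m'.+1 then
    flatten [seq [seq nseq k m ++ s | s <- partitions_le m' (n - k * m)]
            | k <- iota 0 (n %/ m).+1]
  else if n == 0 then [:: [::]] else [::].

(* By mem_partitions and partitions_uniq below, every partition of n is listed
   exactly once. *)
Definition partitions (n : nat) : seq (seq nat) := partitions_le n n.

Definition two_regular (s : seq nat) : bool := all odd s.

(* Rows and columns are numbered from 0. *)
Definition boxes (s : seq nat) : seq (nat * nat) :=
  [seq (i, j) | i <- iota 0 (size s), j <- iota 0 (nth 0 s i)].

Definition arm_length (s : seq nat) (b : nat * nat) : nat :=
  nth 0 s b.1 - b.2.+1.

(* A row has a box in column b.2 iff its length exceeds b.2. *)
Definition leg_length (s : seq nat) (b : nat * nat) : nat :=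
  count (fun row => b.2 < row) (drop b.1.+1 s).

Definition hook_length (s : seq nat) (b : nat * nat) : nat :=
  arm_length s b + leg_length s b + 1.

Definition num_hooks (k : nat) (s : seq nat) : nat :=
  count (fun b => hook_length s b == k) (boxes s).

Definition b2 (k n : nat) : nat :=
  \sum_(s <- partitions n | two_regular s) num_hooks k s.

Lemma mem_partitions_le m n s :
  (s \in partitions_le m n) = is_partition n s && all (geq m) s.
Proof.
have geq_tr : transitive geq by move=> a b c /= ba ac; exact: leq_trans ac ba.
rewrite /is_partition; elim: m n s => [|m IHm] n s.
  rewrite [partitions_le _ _]/=.
  case: s => [|x s]; first by case: n.
  have -> : (x :: s \in if n == 0 then [:: [::]] else [::]) = false.
    by case: ifP.
  by case: x => [|x]; rewrite ?inE ?eqxx ?andbF //= !andbF.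
apply/idP/idP.
  case/flatten_mapP=> k; rewrite mem_iota ltnS leq_divRL // => /andP[_ lek].
  case/mapP=> t; rewrite IHm => /andP[/and3P[st t0 /eqP sumt] allt] ->.
  have allS : all (geq m.+1) (nseq k m.+1 ++ t).
    rewrite all_cat all_nseq /= leqnn orbT.
    by apply: sub_all allt => x /= /leqW.
  rewrite allS mem_cat negb_or t0 mem_nseq andbF sumn_cat sumn_nseq sumt.
  rewrite mulnC subnKC ?eqxx // !andbT.
  rewrite sorted_pairwise // pairwise_cat -(sorted_pairwise _ t) // st andbT.
  apply/andP; split.
    apply/allrelP=> x y; rewrite mem_nseq => /andP[_ /eqP->] /(allP allt) /=.
    exact: leqW.
  by elim: k {lek sumt allS} => //= k ->; rewrite all_nseq /= leqnn orbT.
case/andP=> /and3P[ss s0 /eqP sums] alls.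
have [k [t [def_s allt]]] : exists k t, s = nseq k m.+1 ++ t /\ all (geq m) t.
  elim: s ss alls {s0 sums} => [|x s IHs] ss alls; first by exists 0, [::].
  have /= /andP[lex alls'] := alls.
  have [eqx|nex] := eqVneq x m.+1.
    have [k [t [-> ?]]] := IHs (path_sorted ss) alls'.
    by exists k.+1, t; rewrite eqx.
  exists 0, (x :: s); split=> //=.
  have lexm : x <= m by rewrite -ltnS ltn_neqAle nex.
  rewrite lexm /=; move: ss; rewrite /= path_sortedE // => /andP[/allP lesx _].
  by apply/allP=> y /lesx /= lyx; apply: leq_trans lexm.
have sumE : k * m.+1 + sumn t = n.
  by rewrite -sums def_s sumn_cat sumn_nseq mulnC.
apply/flatten_mapP; exists k.
  by rewrite mem_iota /= add0n ltnS leq_divRL // -sumE leq_addr.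
rewrite def_s; apply: map_f; rewrite IHm allt -sumE addKn eqxx !andbT.
move: ss s0; rewrite def_s mem_cat negb_or => ss /andP[_ ->]; rewrite andbT.
by move: ss; rewrite !sorted_pairwise // pairwise_cat => /and3P[].
Qed.

Lemma mem_partitions n s : (s \in partitions n) = is_partition n s.
Proof.
rewrite mem_partitions_le andb_idr // => /and3P[_ _ /eqP <-].
apply/allP=> x /=; elim: s => //= y s IHs; rewrite inE.
by case/orP=> [/eqP->|/IHs /leq_trans]; [exact: leq_addr | apply; exact: leq_addl].
Qed.

Lemma partitions_uniq n : uniq (partitions n).
Proof.
rewrite /partitions; move: {1}n => m; elim: m n => [|m IHm] n; first by rewrite /=; case: ifP.
rewrite [partitions_le _ _]/=.
apply: (@allpairs_uniq_dep _ (fun=> seq nat) _ (fun k s => nseq k m.+1 ++ s)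
  (iota 0 (n %/ m.+1).+1) (fun k => partitions_le m (n - k * m.+1))).
- exact: iota_uniq.
- by move=> k _; apply: IHm.
move=> _ _ /allpairsPdep[k [s [_ sP ->]]] /allpairsPdep[l [t [_ tP ->]]] /= eq_st.
have noS j u : u \in partitions_le m j -> count_mem m.+1 u = 0.
  rewrite mem_partitions_le => /andP[_ /allP allu]; apply/count_memPn.
  by apply/negP=> /allu /=; rewrite ltnn.
have eq_kl : k = l.
  have /(congr1 (count_mem m.+1)) := eq_st.
  by rewrite !count_cat !count_nseq (noS _ _ sP) (noS _ _ tP) /= eqxx !mul1n !addn0.
move: eq_st; rewrite eq_kl => /eqP; rewrite eqseq_cat ?eqxx //=.
by move/eqP->.
Qed.

(* Main.v *)
Require Import Defs.
From mathcomp Require Import all_boot.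
From mathcomp Require Import zify.

(** A partition into odd parts has one hook of length 1 for each distinct part,
    and one hook of length 2 for each distinct part other than 1 and for each
    repeated part.  So it suffices to find an injection from the odd partitions
    of [n] containing 1 to the pairs of an odd partition of [n] and a repeated
    part [j] of it.  A partition [s] containing 1 twice goes to [(s, 1)].  If [s]
    contains 1 once and a part [2j - 1] with [j > 1] odd, replace [2j - 1, 1] by
    [j, j].  Otherwise the other parts are all 3 modulo 4; if some part is
    [2j + 1 > 3], replace [2j + 1, 1] by [j, j, 1, 1], else [s = (3, ..., 3, 1)]
    and as [n > 4] it goes to [(s, 3)].  For [j > 1] the three last cases are
    told apart by the number of parts 1 in the image: 0, 2 and 1. *)

Lemma geq_trans : transitive geq.
Proof. by move=> a b c /= ba ac; exact: leq_trans ac ba. Qed.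

Lemma num_hooks_cons k x s :
  num_hooks k (x :: s) =
  count (fun j => x - j.+1 + count (fun r => j < r) s + 1 == k) (iota 0 x)
  + num_hooks k s.
Proof.
rewrite /num_hooks /boxes /= count_cat count_map; congr (_ + _).
  by apply: eq_count => j; rewrite /= /hook_length /arm_length /leg_length /= drop0.
have -> : iota 1 (size s) = [seq i.+1 | i <- iota 0 (size s)].
  by rewrite -[1]/(1 + 0) iotaDl.
elim: (iota 0 (size s)) => //= i l IHl; rewrite !count_cat !count_map.
by congr (_ + _).
Qed.

(** A hook of length 1 has arm 0, so its box ends its row, and leg 0, so no lower row is as long. *)
Lemma num_hooks1_cons x s : all (geq x.+1) s ->
  num_hooks 1 (x.+1 :: s) = (x.+1 \notin s) + num_hooks 1 s.
Proof.
move=> le_s; rewrite num_hooks_cons -addn1 iotaD count_cat add0n addn1; congr (_ + _).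
rewrite (@eq_in_count _ _ pred0) ?count_pred0 => [|j]; last first.
  by rewrite mem_iota => /= ?; lia.
rewrite /= addn0 add0n subnn add0n addn1 eqSS -leqn0 leqNgt -has_count.
congr (nat_of_bool (~~ _)); apply/hasP/idP => [[y ys]|]; last by exists x.+1.
by move/(allP le_s): (ys) => /= ? ?; have <- : y = x.+1 by lia.
Qed.

(** Only the last two boxes of the top row matter: the next-to-last one, absent when [x = 1], needs
    leg 0, and the last one needs leg 1. *)
Lemma num_hooks2_cons x s : odd x -> all odd s -> all (geq x) s ->
  num_hooks 2 (x :: s) =
  ((x != 1) && (x \notin s)) + (count_mem x s == 1) + num_hooks 2 s.
Proof.
move=> odd_x odd_s le_s; rewrite num_hooks_cons; congr (_ + _).
(* By parity no row has length [x - 1], so both of these boxes have the same leg: the number of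
   lower rows of length [x]. *)
have cnt y : y < x <= y.+2 -> count (fun r => y < r) s = count_mem x s.
  move=> ?; apply: eq_in_count => z zs.
  by move/(allP le_s): (zs) => /=; move/(allP odd_s): zs => ? ?; lia.
case: x odd_x {odd_s} le_s cnt => [//|[|x]] odd_x le_s cnt.
  rewrite /= addn0 subnn !add0n addn1 eqSS; congr (nat_of_bool (_ == _)).
  apply: cnt; lia.
rewrite -[x.+2]addn2 iotaD count_cat add0n addn2.
rewrite (@eq_in_count _ _ pred0 (iota 0 x)) ?count_pred0 => [|j]; last first.
  by rewrite mem_iota => /= ?; lia.
rewrite /= (cnt x) ?(cnt x.+1); try lia.
have := has_count (pred1 x.+2) s; rewrite has_pred1.
by move: (count_mem _ _) => c; case: (_ \in _); case: c => [|[|c]]; lia.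
Qed.

(** The test [== 1] selects the next-to-last occurrence of a part, so each repeated part is listed
    exactly once. *)
Fixpoint repeated (s : seq nat) : seq nat :=
  if s is x :: s' then
    if count_mem x s' == 1 then x :: repeated s' else repeated s'
  else [::].

Lemma mem_repeated j s : 1 < count_mem j s -> j \in repeated s.
Proof.
elim: s => //= x s IHs; have [->|_] := eqVneq x j; last first.
  by move/IHs; case: ifP; rewrite // inE => _ ->; rewrite orbT.
by case: eqP => [_|? ?]; [rewrite mem_head | apply: IHs; lia].
Qed.

Lemma num_hooks_repeated s : sorted geq s -> all odd s ->
  num_hooks 2 s + (1 \in s) = num_hooks 1 s + size (repeated s).
Proof.
elim: s => // -[//|x] s IHs ss /= /andP[odd_x odd_s].
have := ss; rewrite /= path_sortedE; last exact: geq_trans.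
case/andP=> le_s /IHs /(_ odd_s); rewrite num_hooks1_cons // num_hooks2_cons //.
rewrite inE; have := has_count (pred1 x.+1) s; rewrite has_pred1.
have [<-|?] := eqVneq 1 x.+1; case: eqP => /=; case: (x.+1 \in s); case: (1 \in s); lia.
Qed.

(** With a relation in place of a function, no canonical choice of image is needed. Remove [x] and
    one image [y] of it; by injectivity [y] is related to no other element of [X]. *)
Lemma leq_size_injrel (S T : eqType) (r : S -> T -> Prop) (X : seq S) (Y : seq T) :
  uniq X ->
  (forall x, x \in X -> exists2 y, y \in Y & r x y) ->
  (forall x x' y, x \in X -> x' \in X -> r x y -> r x' y -> x = x') ->
  size X <= size Y.
Proof.
elim: X Y => //= x X IHX Y /andP[xX uX] tot inj.
have [y yY rxy] := tot x (mem_head _ _).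
have Y_gt0 : 0 < size Y by case: Y yY {tot}.
suff : size X <= size (rem y Y) by rewrite size_rem //; lia.
apply: IHX => // [z zX|z z' w zX z'X]; last by apply: inj; rewrite inE ?zX ?z'X orbT.
have zxX : z \in x :: X by rewrite inE zX orbT.
have [w wY rzw] := tot z zxX; exists w => //.
have : w != y.
  apply: contraNneq xX => eq_wy; rewrite -(inj z x y) ?mem_head //.
  by rewrite -eq_wy.
by move=> wy; move: wY; rewrite (perm_mem (perm_to_rem yY)) inE (negPf wy).
Qed.

(** Each exchange of parts is written as an equality of multisets with the removed parts added to
    the other side, so that [t] and [j] determine [s] by cancellation. *)
Definition repeats_odd_part (s : seq nat) (tj : seq nat * nat) : Prop :=
  let: (t, j) := tj in
  [\/ j = 1 /\ s = t,
      [/\ j != 1, count_mem 1 t = 0 & perm_eq [:: j, j & s] [:: 1, j.*2.-1 & t]],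
      [/\ j != 1, count_mem 1 t = 1 & s = t]
    | [/\ j != 1, count_mem 1 t = 2 & perm_eq [:: 1, j, j & s] (j.*2.+1 :: t)]].

Lemma repeats_odd_part_inj s s' tj :
  sorted geq s -> sorted geq s' ->
  repeats_odd_part s tj -> repeats_odd_part s' tj -> s = s'.
Proof.
case: tj => t j ss ss'.
have eqP' : perm_eq s s' -> s = s'.
  by apply: (sorted_eq geq_trans) => // x y /= ?; lia.
case=> [[-> ->]|[j1 c p]|[j1 c ->]|[j1 c p]];
(* Different cases clash on [j = 1] or on the number of parts 1 in [t]. *)
case=> [[j1' e]|[j1' c' p']|[j1' c' e]|[j1' c' p']] //; try lia; subst => //;
by apply: eqP'; move: p; rewrite perm_sym in p'; move/perm_trans/(_ p'); rewrite !perm_cons.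
Qed.

Lemma exists_repeats_odd_part n s : 4 < n ->
  is_partition n s -> all odd s -> 1 \in s ->
  exists t j, [/\ is_partition n t, all odd t, 1 < count_mem j t
                & repeats_odd_part s (t, j)].
Proof.
move=> n_gt4 ps odd_s s1; have /and3P[ss s0 /eqP sumE] := ps.
have sortP u : sumn u = n -> all odd u ->
    is_partition n (sort geq u) /\ all odd (sort geq u).
  move=> sum_u odd_u; rewrite all_sort odd_u /is_partition mem_sort.
  rewrite (perm_sumn (_ : perm_eq _ u)) ?perm_sort // sum_u eqxx andbT.
  rewrite sort_sorted => [|x y /=]; last lia.
  by split=> //; apply/negP => /(allP odd_u).
have cE x : (0 < count_mem x s) = (x \in s) by rewrite -has_count has_pred1.
have [c1|c1] := ltnP 1 (count_mem 1 s).
  by exists s, 1; split=> //; constructor 1.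
have {}c1 : count_mem 1 s = 1 by have := cE 1; rewrite s1; lia.
have p1 := perm_to_rem s1; set u := rem 1 s in p1.
have odd_u : all odd u by have := odd_s; rewrite (perm_all _ p1).
have sum_u : sumn u = n.-1 by have := perm_sumn p1; rewrite sumE /=; lia.
have u1 : count_mem 1 u = 0 by have /permP/(_ (pred1 1)) := p1; rewrite /= c1; lia.
have u1P x : x \in u -> x != 1.
  by move=> xu; apply: contra_eq_neq u1 => eqx; rewrite -lt0n -has_count has_pred1 -eqx.
have remP p : p \in u -> exists v, [/\ all odd v, sumn v + p = n.-1,
    count_mem 1 v = 0 & forall a, count a s = a 1 + (a p + count a v)].
  move=> pu; have p2 := perm_to_rem pu; exists (rem p u); split.
  - by have := odd_u; rewrite (perm_all _ p2) => /andP[].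
  - by have := perm_sumn p2; rewrite sum_u /=; lia.
  - by have /permP/(_ (pred1 1)) := p2; rewrite /= u1; lia.
  by move=> a; have /permP-> := p1; rewrite /=; have /permP-> := p2.
have [/hasP[p pu p4]|/hasPn no1] := boolP (has (fun p => p %% 4 == 1) u).
  (* As [p] is 1 modulo 4 and not 1, it is [2j - 1] with [j = 2q + 3] odd. *)
  have [q pE] : exists q, p = q.*2.*2 + 5.
    by exists (p %/ 4).-1; have := u1P _ pu; move: p4; clear; lia.
  have [v [odd_v sum_v v1 cs]] := remP p pu; pose j := q.*2.+3.
  have [||pt odd_t] := sortP [:: j, j & v].
  - by move: sum_v; rewrite pE /= /j; clear -n_gt4; lia.
  - by rewrite /= odd_double.
  have /permP ct : perm_eq (sort geq [:: j, j & v]) [:: j, j & v] by rewrite perm_sort.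
  exists (sort geq [:: j, j & v]), j; split=> //; first by rewrite ct /= !eqxx.
  constructor 2; split=> //; first by rewrite ct /= v1.
  have -> : j.*2.-1 = p by rewrite pE /j; clear; lia.
  by apply/permP => a; rewrite /= ct cs /=; clear; lia.
have [/hasP[p pu p_gt3]|/hasPn le3] := boolP (has (fun p => 3 < p) u).
  (* Now [p] is 3 modulo 4 and exceeds 3, so it is [2j + 1] with [j = 2q + 3] odd. *)
  have [q pE] : exists q, p = q.*2.*2 + 7.
    exists (p %/ 4).-1; move: (allP odd_u _ pu) (no1 _ pu) p_gt3; clear; lia.
  have [v [odd_v sum_v v1 cs]] := remP p pu; pose j := q.*2.+3.
  have [||pt odd_t] := sortP [:: j, j, 1, 1 & v].
  - by move: sum_v; rewrite pE /= /j; clear -n_gt4; lia.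
  - by rewrite /= odd_double.
  have /permP ct : perm_eq (sort geq [:: j, j, 1, 1 & v]) [:: j, j, 1, 1 & v].
    by rewrite perm_sort.
  exists (sort geq [:: j, j, 1, 1 & v]), j; split=> //; first by rewrite ct /= !eqxx.
  constructor 4; split=> //; first by rewrite ct /= v1.
  have -> : j.*2.+1 = p by rewrite pE /j; clear; lia.
  by apply/permP => a; rewrite /= ct cs /=; clear; lia.
have u3 : all (pred1 3) u.
  apply/allP => x xu /=; move: (u1P _ xu) (no1 _ xu) (le3 _ xu) (allP odd_u _ xu); clear; lia.
exists s, 3; split=> //; last by constructor 3.
have /permP/(_ (pred1 3)) -> := p1.
(* The parts 3 sum to [n - 1], which is at least 4, so there are at least two of them. *)
move/all_pred1P: u3 sum_u => ->; rewrite sumn_nseq /= count_nseq /=; lia.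
Qed.

Theorem theorem1p4 (n : nat) (hn : 4 < n) : b2 2 n >= b2 1 n.
Proof.
pose X := [seq s <- partitions n | two_regular s & 1 \in s].
pose Y := [seq (s, j) | s <- [seq s <- partitions n | two_regular s], j <- repeated s].
have sizeX : size X = \sum_(s <- partitions n | two_regular s) (1 \in s).
  by rewrite -big_mkcondr sum1_count size_filter; apply: eq_count => s; rewrite andbC.
have sizeY : size Y = \sum_(s <- partitions n | two_regular s) size (repeated s).
  by rewrite size_allpairs_dep sumnE big_map big_filter.
(* Adding [size X] on the left accounts for the parts 1, whose rows have no box of arm 1. *)
have : b2 2 n + size X = b2 1 n + size Y.
  rewrite sizeX sizeY /b2 -!big_split /= big_seq_cond [RHS]big_seq_cond.
  apply: eq_bigr => s /andP[]; rewrite mem_partitions => /and3P[ss _ _] odd_s.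
  exact: num_hooks_repeated.
suff : size X <= size Y by lia.
have memX s : s \in X -> [/\ is_partition n s, all odd s & 1 \in s].
  by rewrite mem_filter mem_partitions => /andP[/andP[]].
apply: (@leq_size_injrel _ _ repeats_odd_part) => [|s|s s' tj].
- by rewrite filter_uniq ?partitions_uniq.
- move/memX=> [ps odd_s s1].
  have [t [j [pt odd_t jt r]]] := exists_repeats_odd_part n s hn ps odd_s s1.
  exists (t, j) => //; apply/allpairsPdep; exists t, j; split=> //.
    by rewrite mem_filter mem_partitions pt andbT.
  exact: mem_repeated.
move=> /memX[/and3P[ss _ _] _ _] /memX[/and3P[ss' _ _] _ _].
exact: repeats_odd_part_inj.
Qed.
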